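(* Let $X = X_0+\epsilon X_1$ be a two-dimensional real polynomial vector field, $0<\epsilon\ll1$, whose critical variety $\mathcal{C}=\{X_0=0\}$ is, in a neighbourhood of a point $p_s$, the union $V(F_1)\cup V(F_2)$ of two algebraic curves with $V(F_1)\cap V(F_2)=\{p_s\}$ and intersection number one at $p_s$, subject to the standing assumptions on $X_0$ and $X_1$ listed in the context. If $X_1$ satisfies $$X_1(p_s)\wedge T_{p_s}V(F_1)=0,$$ where $\wedge$ is the exterior product, then $X=X_0+\epsilon X_1$ admits singular canard solutions. Similarly, the same conclusion holds if $X_1(p_s)\wedge T_{p_s}V(F_2)=0$.
   Context: Setting. Write $X_0 = A\,\frac{\partial}{\partial x}+B\,\frac{\partial}{\partial y}$ with $A,B$ real polynomials, and $V(P)=\{p\in\mathbb{R}^2: P(p)=0\}$. The critical variety is $\mathcal{C}=\{p\in\mathbb{R}^2 : X_0(p)=0\}=V(A)\cap V(B)$, and the problem is singular, i.e. $\dim\mathcal{C}=1$. $A$ and $B$ have two common irreducible components $F_1,F_2$ with $V(F_1)\cap V(F_2)=\{p_s\}$ and $V(F_1)\cup V(F_2)=\mathcal{C}$, the curves $V(F_1), V(F_2)$ having intersection number one at $p_s$ (so both are smooth at $p_s$ and meet transversely there; this prescribes the typical geometry of nondegenerate transcritical and pitchfork singularities). Put $F=F_1F_2$, so $V(F)=\mathcal{C}$ and its singular set is $\{p_s\}$. Everything is restricted to a neighbourhood of $p_s$ containing no other intersection points. The rank of the Jacobian $\mathrm{D}X_0$ is maximal along each of the four one-dimensional branches of $\mathcal{C}\setminus\{p_s\}$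 (the one-dimensional Whitney strata of $\mathcal{C}$). Fast-foliation and reduced problem. $X_0$ defines a foliation of the phase space (the fast-foliation), generically transverse to $\mathcal{C}$. On the regular part $\mathcal{C}\setminus\{p_s\}$, $\pi: T_{\mathcal{C}}\mathbb{R}^2\to T\mathcal{C}$ denotes the projection of vectors based on $\mathcal{C}$ onto the tangent space of $\mathcal{C}$ along the fast-foliation. The reduced problem (reduced flow) is the flow of $\pi\circ X_1$ on regular sections of $\mathcal{C}$. Assumptions on $X_1$: $\|X_1(p_s)\|=O(1)$ (in particular $X_1(p_s)\neq0$), and the reduced flow has no equilibria in a sufficiently large neighbourhood of $p_s$. Notation. $T_{p_s}V(F_i)$ is the tangent line of $V(F_i)$ at $p_s$; the condition $X_1(p_s)\wedge T_{p_s}V(F_i)=0$ means $X_1(p_s)\wedge v=0$ for all $v\in T_{p_s}V(F_i)$, i.e. $X_1(p_s)$ is tangent to $V(F_i)$. Singular canard. A singular canard is a solution of the reduced problem passing through the singular point $p_s$ with nonzero finite speed, i.e. a $C^1$ curve $\gamma:(-\delta,\delta)\to\mathcal{C}$ with $\gamma(0)=p_s$, $\gamma'(0)\neq0$, that solves the reduced problem away from $p_s$. No distinction is made between canards (attracting to repelling) and faux-canards (repelling to attracting). *)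

(* Defs.v *)
From mathcomp Require Import all_boot all_order all_algebra.
From mathcomp Require Import all_classical all_reals all_analysis.
(* The notations of [mpoly] clash with those of MathComp-Analysis, hence the
   partial import and the qualified names. *)
From mathcomp Require mpoly.
Export (canonicals) mpoly.

Set Implicit Arguments.
Unset Strict Implicit.
Unset Printing Implicit Defensive.

Import Order.TTheory GRing.Theory Num.Theory.
Import numFieldNormedType.Exports.

Local Open Scope classical_set_scope.
Local Open Scope ring_scope.

(* Real polynomials in the two phase variables (indices 0 and 1 of ['I_2]), and
   planar polynomial vector fields, given by their two components. *)
Notation poly2 R := (mpoly.mpoly 2 R).
Notation vfield2 R := 'rV[poly2 R]_2.

Section Algebra.
Variable R : realType.
Implicit Types (F G : poly2 R) (X : vfield2 R) (p : 'rV[R]_2).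

Definition evalp F p : R := mpoly.meval (p 0) F.

Definition evalv X p : 'rV[R]_2 := \row_i evalp (X 0 i) p.

Definition V F : set 'rV[R]_2 := [set p | evalp F p = 0].

Definition critical_variety X : set 'rV[R]_2 := [set p | evalv X p = 0].

(* 0 is excluded: it is not a unit and 0 = 0 * 0. *)
Definition irreducible F : Prop :=
  F \isn't a GRing.unit /\
  forall G H : poly2 R,
    F = G * H -> G \is a GRing.unit \/ H \is a GRing.unit.

(* Where F vanishes, the Jacobian of F N is N dF, of rank at most 1; maximal rank
   of D X0 along the critical variety therefore means rank 1. *)
Definition jac X p : 'M[R]_2 :=
  \matrix_(i, j) evalp (mpoly.mderiv j (X 0 i)) p.

Definition grad F p : 'rV[R]_2 := \row_i evalp (mpoly.mderiv i F) p.

(* The row space of this matrix is {v | dF(p) v = 0}, which is the tangent line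
   of V(F) at p when dF(p) <> 0. *)
Definition tangent F p : 'M[R]_2 := kermx (grad F p)^T.

Definition wedge (u v : 'rV[R]_2) : R := u 0 0 * v 0 1 - u 0 1 * v 0 0.

(* [O_p], inside the field of rational functions *)
Definition local_ring p : set {fraction (poly2 R)} :=
  [set x | exists f g : poly2 R,
     evalp g p != 0 /\ x = FracField.tofrac f / FracField.tofrac g].

(* the ideal (F, G) O_p *)
Definition local_ideal F G p : set {fraction (poly2 R)} :=
  [set x | exists u v, [/\ local_ring p u, local_ring p v &
     x = u * FracField.tofrac F + v * FracField.tofrac G]].

(* dim_R O_p / (F, G) O_p = n: the classes of e_0, ..., e_(n-1) form a basis *)
Definition intersection_number F G p (n : nat) : Prop :=
  exists e : 'I_n -> {fraction (poly2 R)},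
    (forall i, local_ring p (e i)) /\
    forall x, local_ring p x ->
      exists! c : 'rV[R]_n,
        local_ideal F G p
          (x - \sum_i FracField.tofrac (mpoly.mpolyC 2 (c 0 i)) * e i).

End Algebra.

(* In this section F = F1 * F2, and N is the polynomial vector field such that
   X0 = F N; it spans the fast-foliation, including at the points where X0
   vanishes. *)
Section ReducedProblem.
Variable R : realType.
Variables (F : poly2 R) (N X1 : vfield2 R) (ps : 'rV[R]_2) (U : set 'rV[R]_2).
Implicit Types (G : poly2 R) (p : 'rV[R]_2).

Definition fast_transverse p : Prop :=
  row_full (tangent F p + evalv N p)%MS.

(* the points at which the projection along the fast-foliation is defined *)
Definition slow_points : set 'rV[R]_2 :=
  [set p | [/\ U p, V F p, p <> ps & fast_transverse p]].

(* pi (X1 p), where pi projects onto the tangent line of V(F) along the fast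
   direction; meaningful for p in slow_points *)
Definition reduced p : 'rV[R]_2 :=
  evalv X1 p *m proj_mx (tangent F p) <<evalv N p>>%MS.

Definition generically_transverse G : Prop :=
  V G `&` U `<=` closure (V G `&` slow_points).

(* The reduced flow on the branch V(G) is not defined at ps itself: ps is an
   equilibrium of its continuous extension when the reduced velocity tends to 0
   along V(G). *)
Definition equilibrium_at_ps G : Prop :=
  reduced p @[p --> within (V G `&` slow_points) (nbhs ps)] --> (0 : 'rV[R]_2).

Definition singular_canard (X0 : vfield2 R) (gamma : R -> 'rV[R]_2)
    (delta : R) : Prop :=
  [/\ 0 < delta,
      (forall t, `|t| < delta ->
         derivable gamma t 1 /\ {for t, continuous (derive1 gamma)}),
      (forall t, `|t| < delta -> (critical_variety X0 `&` U) (gamma t)),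
      gamma 0 = ps /\ derive1 gamma 0 != 0 &
      forall t, `|t| < delta -> gamma t <> ps ->
        slow_points (gamma t) /\ derive1 gamma t = reduced (gamma t)].

End ReducedProblem.

(* Main.v *)
Require Import Defs.
From mathcomp Require Import all_boot all_order all_algebra.
From mathcomp Require Import all_classical all_reals all_analysis.
From mathcomp Require Import ring lra.

(** Let F, G be the two components, F the one whose tangent at [ps] contains
    X1(ps).  Write g for the gradient of F and x.y for the scalar product.

    On V(F), away from [ps], the gradient of F G is a nonzero multiple of g, so
    where g.N does not vanish the projection along N onto the tangent of V(F)
    sends X1 to
      E = X1 - (g.X1 / g.N) N                                    ([reducedM]).
    The vector field E does not know about G, and it is defined and continuous
    wherever g.N <> 0, possibly at [ps] too.  If g.N <> 0 at [ps], then the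
    tangency g.X1 = 0 gives E(ps) = X1(ps) <> 0: the reduced flow on V(F)
    extends through [ps] as a regular flow, and the canard is its trajectory
    through [ps].

    It remains to see that N is transverse to V(F) at [ps]
    ([fast_direction_transverse]).  Intersection number one makes the gradients
    of F and G independent at [ps] ([intersection_number1_transverse]), so if N
    were tangent to V(F) at [ps] it would be transverse to V(G), and X1(ps),
    also tangent to V(F), would be a multiple of N(ps).  The projection along N
    onto V(G) then kills X1 at [ps]: the reduced flow on the other branch V(G)
    has an equilibrium at [ps], which is excluded.

    The trajectory is found with one-dimensional means.  With t = X1(ps) and
    n = N(ps), the curve V(F) is near [ps] a graph c(s) = ps + s t + phi(s) n
    ([local_curve]).  Both c'(s) and E(c(s)) are orthogonal to g, hence
    E(c(s)) = lam(s) c'(s) with lam continuous and lam(0) = 1.  The scalar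
    equation S' = lam(S), S(0) = 0 is solved by inverting a primitive of 1/lam
    ([scalar_flow]), and gamma = c o S is the canard ([canard_along]). *)

Set Implicit Arguments.
Unset Strict Implicit.
Unset Printing Implicit Defensive.

Import Order.TTheory GRing.Theory Num.Theory.
Import numFieldNormedType.Exports.

Local Open Scope classical_set_scope.
Local Open Scope ring_scope.

(** * A scalar autonomous equation *)

Section ScalarFlow.
Variable R : realType.
Implicit Types lam : R -> R.

(** Separation of variables: if T is a primitive of 1/lam, then S = T^-1 has
    derivative 1 / T'(S) = lam(S). *)
Lemma scalar_flow lam :
  (\forall s \near (0 : R), {for s, continuous lam}) -> 0 < lam 0 ->
  exists S : R -> R, S 0 = 0 /\
    \forall t \near (0 : R), is_derive (t : R) (1 : R) S (lam (S t)).
Proof.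
move=> lamC lam0.
have lamP : \forall s \near (0 : R), 0 < lam s.
  by have := nbhs_singleton lamC; rewrite /prop_for /continuous_at => /cvgr_gt; exact.
have [e /= e0 lamCP] : nbhs_ball (0 : R) _ := (nbhs_ballP _ _).1 (filterI lamC lamP).
pose b := e / 2.
have b0 : 0 < b by rewrite divr_gt0.
have be : b < e by rewrite ltr_pdivrMr// ltr_pMr// ltr1n.
have lamE s : `|s| <= b -> {for s, continuous lam} /\ 0 < lam s.
  move=> sb; apply: lamCP.
  by rewrite -ball_normE/= sub0r normrN (le_lt_trans sb).
pose f s := (lam s)^-1.
have fC s : `|s| <= b -> {for s, continuous f}.
  by move=> /lamE[sC s0]; apply: cvgV => //; rewrite gt_eqF.
have inb x : (x \in `]- b, b[) = (`|x| < b) by rewrite in_itv/= ltr_norml.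
pose I x := (\int[@lebesgue_measure R]_(t in `[(- b), x]) f t)%R.
have ID x : `|x| < b -> is_derive (x : R) (1 : R) I (f x).
  rewrite ltr_norml => /andP[bx xb].
  have [||dI I'] := @continuous_FTC1_closed R f (- b) x b xb _ bx.
  - apply: continuous_compact_integrable; first exact: segment_compact.
    apply: continuous_in_subspaceT => y /set_mem/=; rewrite in_itv/= => yb.
    by apply: fC; rewrite ler_norml.
  - by apply: fC; rewrite ler_norml !ltW.
  by apply: DeriveDef => //; rewrite -derive1E.
pose T x := I x - I 0.
have T0 : T 0 = 0 by rewrite /T subrr.
have TD x : `|x| < b -> is_derive (x : R) (1 : R) T (f x).
  move=> /ID h; rewrite /T -[f x]subr0; exact: is_deriveB.
have TC x : `|x| < b -> {for x, continuous T}.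
  move=> xb; apply: differentiable_continuous; apply/derivable1_diffP.
  by have h := TD _ xb; exact: ex_derive.
have T_mono : {in `]- b, b[ &, {homo T : x y / x < y}}.
  apply: gtr0_derive1_lt_oo => x.
  - by rewrite inb => /TD h; exact: ex_derive.
  - rewrite inb => xb; have h := TD _ xb.
    by rewrite derive1E derive_val invr_gt0; case: (lamE x (ltW xb)).
  - by move=> /set_mem/=; rewrite inb; exact: TC.
have T_inj x y : `|x| < b -> `|y| < b -> T x = T y -> x = y.
  rewrite -!inb => xb yb Txy; case: (ltgtP x y) => // /T_mono.
    by move=> /(_ xb yb); rewrite Txy ltxx.
  by move=> /(_ yb xb); rewrite Txy ltxx.
pose g y := get [set x | `|x| < b /\ T x = y].
have TK x : `|x| < b -> g (T x) = x.
  move=> xb; rewrite /g; case: xgetP => [z _ [zb /T_inj ->]//|/(_ x)[]].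
  by split.
have near_b x : `|x| < b -> \forall z \near x, `|z| < b.
  by move=> xb; apply: (cvgr_norm_lt x) => //; exact: cvg_id.
have near0b : \forall z \near (0 : R), `|z| < b by apply: near_b; rewrite normr0.
(* a continuous injection is locally a homeomorphism, so that the left inverse g
   of T is a continuous right inverse near T 0 *)
have [] : {near T 0, continuous g} /\ {near T 0, cancel g T}.
  apply: near_can_continuousAcan_sym; near=> x; [apply: TK|apply: TC].
    by near: x; exact: near0b.
  by near: x; exact: near0b.
rewrite T0 => gC gK.
have g0 : g 0 = 0 by rewrite -[X in g X]T0 TK ?normr0.
exists g; split => //.
have g_near : \forall y \near (0 : R), `|g y| < b.
  by have := nbhs_singleton gC; rewrite /continuous_at g0 => h; exact: h near0b.
near=> t.
have gb : `|g t| < b by near: t.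
have gTt : T (g t) = t by near: t.
rewrite -{1}gTt -[lam _]invrK; apply: (@is_derive_inverse _ T); last 1 first.
- by rewrite invr_eq0 gt_eqF//; case: (lamE _ (ltW gb)).
- by near=> x; apply: TK; near: x; exact: near_b gb.
- by near=> x; apply: TC; near: x; exact: near_b gb.
- exact: TD.
Unshelve. all: by end_near. Qed.
End ScalarFlow.

(** * The implicit function theorem for functions with continuous slopes *)

(** A function of two variables is given together with continuous functions P and
    Q of pairs of points expressing its increments.  Their values on the diagonal
    are the partial derivatives; having them off the diagonal as well turns every
    mean value argument into algebra. *)
Section ImplicitFunction.
Variable R : realType.
Variables (f : R -> R -> R) (P Q : R * R -> R * R -> R).
Hypothesis fPQ : forall s u s' u',
  f s' u' - f s u = (s' - s) * P (s, u) (s', u') + (u' - u) * Q (s, u) (s', u').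
Hypothesis Pc : continuous (fun z : (R * R) * (R * R) => P z.1 z.2).
Hypothesis Qc : continuous (fun z : (R * R) * (R * R) => Q z.1 z.2).

Lemma cvg_slope (S : R * R -> R * R -> R) (x y : R) (h : R -> R) :
  continuous (fun z : (R * R) * (R * R) => S z.1 z.2) ->
  {for x, continuous h} ->
  (fun z => S (x, y) (z, h z)) @ x --> S (x, y) (x, h x).
Proof.
move=> Sc hc; apply: (@continuous2_cvg _ _ _ _ (nbhs x) _
  (fun=> (x, y)) (fun z => (z, h z)) S (x, y) (x, h x)).
- exact: (Sc ((x, y), (x, h x))).
- exact: cvg_cst.
- apply: (@cvg_pair _ _ _ (nbhs x) (nbhs x) (nbhs (h x))); [exact: cvg_id|exact: hc].
Qed.

(** The increment from (s, phi s) to (z, phi z) is 0, whence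
    phi z - phi s = - P / Q (z - s) with P and Q taken at that pair of points.
    Boundedness of P / Q makes phi Lipschitz, and then the continuity of P / Q
    turns this identity into the derivative of phi. *)
Lemma implicit_function : f 0 0 = 0 -> Q (0, 0) (0, 0) != 0 ->
  exists phi : R -> R, phi 0 = 0 /\
    \forall s \near (0 : R), [/\ f s (phi s) = 0, Q (s, phi s) (s, phi s) != 0 &
      is_derive (s : R) (1 : R) phi
        (- P (s, phi s) (s, phi s) / Q (s, phi s) (s, phi s))].
Proof.
move=> f00; set q := Q (0, 0) (0, 0) => q0.
(* multiplying by q allows Q to have either sign: near the origin Q q > m > 0 *)
pose m := q ^+ 2 / 2; pose M := `|P (0, 0) (0, 0) * q| + 1.
have m0 : 0 < m by rewrite divr_gt0// exprn_even_gt0.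
have M0 : 0 < M by rewrite ltr_pwDr.
have nearQ : \forall z \near ((0, 0), (0, 0)) : (R * R) * (R * R), m < Q z.1 z.2 * q.
  have : (fun z : (R * R) * (R * R) => Q z.1 z.2 * q) @ ((0, 0), (0, 0)) --> q * q.
    have h := @Qc ((0, 0), (0, 0)); rewrite /continuous_at /= -/q in h.
    by apply: cvgM; [exact: h|exact: cvg_cst].
  move=> h; apply: (cvgr_gt _ h); rewrite -expr2 /m ltr_pdivrMr// ltr_pMr ?ltr1n//.
  by rewrite exprn_even_gt0.
have nearP : \forall z \near ((0, 0), (0, 0)) : (R * R) * (R * R), `|P z.1 z.2 * q| < M.
  have : (fun z : (R * R) * (R * R) => P z.1 z.2 * q) @ ((0, 0), (0, 0)) --> P (0, 0) (0, 0) * q.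
    have h := @Pc ((0, 0), (0, 0)); rewrite /continuous_at /= in h.
    by apply: cvgM; [exact: h|exact: cvg_cst].
  by move=> h; apply: (cvgr_norm_lt _ h); rewrite /M ltrDl.
clearbody m M.
have [e /= e0 boxe] := (nbhs_ballP _ _).1 (filterI nearQ nearP).
have box s u s' u' : `|s| < e -> `|u| < e -> `|s'| < e -> `|u'| < e ->
    m < Q (s, u) (s', u') * q /\ `|P (s, u) (s', u') * q| < M.
  move=> hs hu hs' hu'; apply: (boxe ((s, u), (s', u'))).
  by split; split; rewrite /= -ball_normE/= sub0r normrN.
have [b b0 be] : exists2 b, 0 < b & b < e.
  by exists (e / 2); rewrite ?divr_gt0// ltr_pdivrMr// ltr_pMr// ltr1n.
(* for |s| < a the term s P is dominated by the terms (+- b) Q, so that f s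
   changes sign on [-b, b] *)
pose a := Num.min b (b * m / M).
have a0 : 0 < a by rewrite lt_min b0 divr_gt0// mulr_gt0.
have ae (s : R) : `|s| < a -> `|s| < e.
  by rewrite lt_min => /andP[+ _] => /lt_trans; exact.
have aM (s : R) : `|s| < a -> `|s| * M < b * m.
  by rewrite lt_min => /andP[_]; rewrite ltr_pdivlMr.
have uniq s u v : `|s| < a -> `|u| <= b -> `|v| <= b -> f s u = 0 -> f s v = 0 -> u = v.
  move=> /ae se /le_lt_trans/(_ be) ue /le_lt_trans/(_ be) ve fu fv.
  have := fPQ s v s u; rewrite fu fv !subrr mul0r add0r => /esym/eqP.
  rewrite mulf_eq0 subr_eq0 => /orP[/eqP//|/eqP Q0].
  by have [] := box s v s u se ve se ue; rewrite Q0 mul0r ltNge ltW.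
have fc s : continuous (f s).
  move=> u; apply: differentiable_continuous; apply/derivable1_diffP.
  have : is_derive (u : R) (1 : R) (f s) (Q (s, u) (s, u)).
    apply/is_derive1_caratheodory; exists (fun z => Q (s, u) (s, z)); split => //.
      by move=> z; rewrite fPQ subrr mul0r add0r mulrC.
    apply: (@continuous2_cvg _ _ _ _ (nbhs u) _
      (fun=> (s, u)) (fun z => (s, z)) Q (s, u) (s, u)).
    - exact: (@Qc ((s, u), (s, u))).
    - exact: cvg_cst.
    - by apply: (@cvg_pair _ _ _ (nbhs u) (nbhs s) (nbhs u)); [exact: cvg_cst|exact: cvg_id].
  by move=> h; exact: ex_derive.
have exist s : `|s| < a -> exists u, `|u| <= b /\ f s u = 0.
  move=> sa; have se := ae _ sa; have sM := aM _ sa.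
  have side (v : R) : `|v| = b -> 0 < v * (f s v * q).
    move=> vb; have [Qq Pq] : m < Q (0, 0) (s, v) * q /\ `|P (0, 0) (s, v) * q| < M.
      by apply: box; rewrite ?normr0// vb.
    have -> : v * (f s v * q) =
        v ^+ 2 * (Q (0, 0) (s, v) * q) + v * s * (P (0, 0) (s, v) * q).
      by have := fPQ 0 0 s v; rewrite f00 !subr0 => ->; ring.
    have low : - (b * (`|s| * M)) <= v * s * (P (0, 0) (s, v) * q).
      rewrite lerNl (le_trans (ler_norm _))// normrN !normrM vb -!mulrA.
      by rewrite ler_pM2l// ler_wpM2l// -normrM ltW.
    have -> : v ^+ 2 = b ^+ 2 by rewrite -vb real_normK// num_real.
    have := ltr_pM2l b0 (`|s| * M) (b * m); rewrite sM => up.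
    have : b ^+ 2 * m < b ^+ 2 * (Q (0, 0) (s, v) * q) by rewrite ltr_pM2l// exprn_gt0.
    rewrite expr2 -mulrA; lra.
  have [|||u ub fu] := @IVT R (fun u => f s u * q) (- b) b 0.
  - by rewrite ge0_cp// ltW.
  - apply: continuous_subspaceT => u.
    by apply: (@cvgM _ _ (nbhs u)); [exact: fc|exact: cvg_cst].
  - have := side b; have := side (- b); rewrite normrN gtr0_norm// => /(_ erefl) + /(_ erefl).
    rewrite mulNr oppr_gt0 (pmulr_rlt0 _ b0) (pmulr_rgt0 _ b0) => fl fr.
    by rewrite ge_min le_max (ltW fl) (ltW fr) orbT.
  exists u; split; first by move: ub; rewrite in_itv/= ler_norml.
  by apply/eqP; move/eqP: fu; rewrite mulf_eq0 (negbTE q0) orbF.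
pose phi s := get [set u | `|u| <= b /\ f s u = 0].
have phiP s : `|s| < a -> `|phi s| <= b /\ f s (phi s) = 0.
  by move=> /exist[u hu]; rewrite /phi; case: xgetP => [z _ //|/(_ u)[]].
have phi0 : phi 0 = 0.
  have [|h1 h2] := phiP 0; first by rewrite normr0.
  by apply: (uniq 0) => //; rewrite normr0// ltW.
exists phi; split => //.
have near_a (x : R) : `|x| < a -> \forall z \near x, `|z| < a.
  by move=> xa; apply: (@cvgr_norm_lt _ _ _ (nbhs x) _ id x) => //; exact: cvg_id.
have boxphi s z : `|s| < a -> `|z| < a ->
    m < Q (s, phi s) (z, phi z) * q /\ `|P (s, phi s) (z, phi z) * q| < M.
  move=> sa za; have [h1 _] := phiP _ sa; have [h2 _] := phiP _ za.
  by apply: box; [exact: ae|exact: le_lt_trans h1 be|exact: ae|exact: le_lt_trans h2 be].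
have Qn0 s z : `|s| < a -> `|z| < a -> Q (s, phi s) (z, phi z) != 0.
  move=> sa za; have [+ _] := boxphi _ _ sa za; apply: contraTneq => ->.
  by rewrite mul0r ltNge negbK ltW.
have slope s z : `|s| < a -> `|z| < a ->
    phi z - phi s = - P (s, phi s) (z, phi z) / Q (s, phi s) (z, phi z) * (z - s).
  move=> sa za; have Qn := Qn0 _ _ sa za.
  have := fPQ s (phi s) z (phi z).
  rewrite (phiP _ sa).2 (phiP _ za).2 subrr => h.
  apply: (mulIf Qn); rewrite mulrAC divfK//.
  by apply/eqP; rewrite -subr_eq0; apply/eqP; rewrite [RHS]h; ring.
have phic s : `|s| < a -> {for s, continuous phi}.
  move=> sa; apply/cvgrPdist_le => eps eps0.
  near=> z.
  have za : `|z| < a by near: z; exact: near_a.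
  have [Qm PM] := boxphi _ _ sa za.
  rewrite distrC slope// normrM.
  have -> : - P (s, phi s) (z, phi z) / Q (s, phi s) (z, phi z) =
    - (P (s, phi s) (z, phi z) * q / (Q (s, phi s) (z, phi z) * q)).
    by rewrite mulNr -mulf_div divff// mulr1.
  rewrite normrN normf_div (@le_trans _ _ (M / m * `|z - s|))//.
    apply: ler_wpM2r => //; apply: ler_pM; rewrite ?invr_ge0//; first exact: ltW PM.
    have Qmn := le_trans (ltW Qm) (ler_norm _).
    by rewrite lef_pV2 ?posrE//; exact: lt_le_trans m0 Qmn.
  rewrite -ler_pdivlMl ?divr_gt0// distrC; near: z.
  apply: (@cvgr_dist_le _ _ _ (nbhs s) _ id s); first exact: cvg_id.
  by rewrite mulr_gt0// invr_gt0 divr_gt0.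
near=> s.
have sa : `|s| < a by near: s; apply: near_a; rewrite normr0.
split; [exact: (phiP _ sa).2|exact: Qn0|].
apply/is_derive1_caratheodory.
(* Caratheodory's criterion wants a slope at every z: outside |z| < a it is the
   plain difference quotient *)
exists (fun z => if `|z| < a then - P (s, phi s) (z, phi z) / Q (s, phi s) (z, phi z)
  else (phi z - phi s) / (z - s)); split; last by rewrite sa.
- move=> z; case: ifPn => za; first by rewrite slope.
  rewrite divfK// subr_eq0; apply: contraNneq za => ->; exact: sa.
- rewrite /prop_for /continuous_at sa.
  have lim : (fun z => - P (s, phi s) (z, phi z) / Q (s, phi s) (z, phi z)) @ s -->
      - P (s, phi s) (s, phi s) / Q (s, phi s) (s, phi s).
    apply: (@cvgM _ _ (nbhs s)).
      by apply: (@cvgN _ _ _ (nbhs s)); exact: cvg_slope (phic _ sa).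
    by apply: (@cvgV _ _ (nbhs s)); [exact: Qn0|exact: cvg_slope (phic _ sa)].
  apply: cvg_trans lim; apply: near_eq_cvg.
  by apply: filterS (near_a _ sa) => z za; rewrite /= za.
Unshelve. all: by end_near. Qed.
End ImplicitFunction.

(** * Plane vectors *)

Section Rows.
Variable R : realType.
Implicit Types (a : R) (u v w : 'rV[R]_2).

Definition dot u v : R := u 0 0 * v 0 0 + u 0 1 * v 0 1.

Definition quarter_turn v : 'rV[R]_2 := \row_j if j == 0 then - v 0 1 else v 0 0.

Lemma dotDl u v w : dot (u + v) w = dot u w + dot v w.
Proof. by rewrite /dot !mxE; ring. Qed.

Lemma dotZl a u v : dot (a *: u) v = a * dot u v.
Proof. by rewrite /dot !mxE; ring. Qed.

Lemma dotDr u v w : dot u (v + w) = dot u v + dot u w.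
Proof. by rewrite /dot !mxE; ring. Qed.

Lemma dotBr u v w : dot u (v - w) = dot u v - dot u w.
Proof. by rewrite /dot !mxE; ring. Qed.

Lemma dotZr a u v : dot u (a *: v) = a * dot u v.
Proof. by rewrite /dot !mxE; ring. Qed.

Lemma rV2P u v : u 0 0 = v 0 0 -> u 0 1 = v 0 1 -> u = v.
Proof.
move=> h0 h1; apply/rowP => j; case: j => -[|[|//]] jlt.
  by rewrite (_ : Ordinal jlt = 0)//; apply: val_inj.
by rewrite (_ : Ordinal jlt = 1)//; apply: val_inj.
Qed.

Lemma wedge_dot_eq0 u v w : wedge u v != 0 -> dot u w = 0 -> dot v w = 0 -> w = 0.
Proof.
rewrite /wedge /dot => uv uw vw.
apply: rV2P; rewrite mxE; apply: (mulIf uv); rewrite mul0r.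
  transitivity ((u 0 0 * w 0 0 + u 0 1 * w 0 1) * v 0 1 -
                (v 0 0 * w 0 0 + v 0 1 * w 0 1) * u 0 1); first by ring.
  by rewrite uw vw !mul0r subrr.
transitivity ((v 0 0 * w 0 0 + v 0 1 * w 0 1) * u 0 0 -
              (u 0 0 * w 0 0 + u 0 1 * w 0 1) * v 0 0); first by ring.
by rewrite uw vw !mul0r subrr.
Qed.

Lemma colinear_dot u v w : wedge v w = 0 -> dot u w *: v = dot u v *: w.
Proof.
move=> vw; apply: rV2P; rewrite !mxE; apply/eqP; rewrite -subr_eq0; apply/eqP.
  by transitivity (u 0 1 * wedge v w);
    [rewrite /dot /wedge; ring|rewrite vw mulr0].
by transitivity (- u 0 0 * wedge v w);
  [rewrite /dot /wedge; ring|rewrite vw mulr0].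
Qed.

Lemma wedge_self u : wedge u u = 0.
Proof. by rewrite /wedge mulrC subrr. Qed.

Lemma wedge_antisym u v : wedge u v = - wedge v u.
Proof. by rewrite /wedge; ring. Qed.

Lemma dot_rot u v : dot u (quarter_turn v) = wedge v u.
Proof. by rewrite /dot /wedge !mxE /=; ring. Qed.

Lemma wedge_rot u v : wedge u (quarter_turn v) = dot u v.
Proof. by rewrite /dot /wedge !mxE /=; ring. Qed.

Lemma dotC u v : dot u v = dot v u.
Proof. by rewrite /dot; ring. Qed.

Lemma rot_neq0 v : v != 0 -> quarter_turn v != 0.
Proof.
apply: contraNneq => /rowP v0; apply/eqP; apply: rV2P; rewrite mxE.
  by have := v0 1; rewrite !mxE.
by have := v0 0; rewrite !mxE /= => /eqP; rewrite oppr_eq0 => /eqP.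
Qed.

Lemma dependent_kernel u v : wedge u v = 0 ->
  exists2 w, w != 0 & dot u w = 0 /\ dot v w = 0.
Proof.
move=> uv.
have [u0|un0] := eqVneq u 0; last first.
  by exists (quarter_turn u); rewrite ?rot_neq0// !dot_rot wedge_self.
have [v0|vn0] := eqVneq v 0; last first.
  by exists (quarter_turn v); rewrite ?rot_neq0// !dot_rot wedge_self wedge_antisym uv oppr0.
exists (const_mx 1); last by rewrite u0 v0 /dot !mxE !mul0r addr0.
by apply/eqP => /rowP/(_ 0); rewrite !mxE => /eqP; rewrite oner_eq0.
Qed.

(** If g is the gradient along a curve that is a graph in the direction n over the
    direction t, the vector in parentheses is the velocity of the graph; e and
    this velocity lie on the line orthogonal to g, and the factor between them is
    read off by wedging with n. *)
Lemma tangent_graph_velocity (g t n e : 'rV[R]_2) :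
  wedge t n != 0 -> dot g n != 0 -> dot g e = 0 ->
  e = (wedge e n / wedge t n) *: (t + (- dot g t / dot g n) *: n).
Proof.
move=> tn gn ge; apply/eqP; rewrite -subr_eq0; apply/eqP; set w := _ - _.
have gw : dot g w = 0.
  by rewrite dotBr ge dotZr dotDr dotZr divfK// subrr mulr0 subrr.
apply: (@wedge_dot_eq0 g (quarter_turn n) w) gw _; first by rewrite wedge_rot.
have nE v : dot (quarter_turn n) v = - wedge v n by rewrite dotC dot_rot wedge_antisym.
rewrite /w dotBr dotZr dotDr dotZr !nE wedge_self oppr0 mulr0 addr0.
by rewrite mulrN divfK// subrr.
Qed.

Lemma cvg_row (T : Type) (A : set_system T) {FA : Filter A} (f : T -> 'rV[R]_2) u :
  (forall j, (fun t => f t 0 j) @ A --> u 0 j) -> f @ A --> u.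
Proof.
move=> fu; apply/cvgrPdist_le => e e0; near=> t.
rewrite /Num.Def.normr/= mx_normrE (bigmax_le _ (ltW e0))//= => i _.
rewrite !mxE/= ord1; move: (i.2); near: t; apply: filter_forall => j.
exact: ((cvgrPdist_le _ _).1 (fu j)).
Unshelve. all: by end_near. Qed.

Lemma coord_cvg (T : Type) (A : set_system T) {FA : Filter A} (f : T -> 'rV[R]_2) u j :
  f @ A --> u -> (fun t => f t 0 j) @ A --> u 0 j.
Proof. by move=> fu; exact: (cvg_comp _ _ fu (@coord_continuous _ _ _ _ _ _)). Qed.

Lemma cvg_dot (T : Type) (A : set_system T) {FA : Filter A} (f g : T -> 'rV[R]_2) u v :
  f @ A --> u -> g @ A --> v -> (fun t => dot (f t) (g t)) @ A --> dot u v.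
Proof. by move=> fu gv; apply: cvgD; apply: cvgM; exact: coord_cvg. Qed.

Lemma cvg_wedge (T : Type) (A : set_system T) {FA : Filter A} (f g : T -> 'rV[R]_2) u v :
  f @ A --> u -> g @ A --> v -> (fun t => wedge (f t) (g t)) @ A --> wedge u v.
Proof. by move=> fu gv; apply: cvgB; apply: cvgM; exact: coord_cvg. Qed.

Lemma is_derive_curve (p t n : 'rV[R]_2) (x y : R -> R) (s dx dy : R) :
  is_derive (s : R) (1 : R) x dx -> is_derive (s : R) (1 : R) y dy ->
  is_derive (s : R) (1 : R) (fun s => p + x s *: t + y s *: n)
    (dx *: t + dy *: n).
Proof.
move=> hx hy.
have coord j : is_derive (s : R) (1 : R) (fun s => (p + x s *: t + y s *: n) 0 j)
    ((dx *: t + dy *: n) 0 j).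
  rewrite (_ : (fun s => _) = (cst (p 0 j) + x * cst (t 0 j)) + y * cst (n 0 j)); last first.
    by apply/funext => z; rewrite !mxE.
  apply: is_derive_eq; rewrite !mxE !scaler0 !add0r; congr (_ + _); exact: mulrC.
have der : derivable (fun s => p + x s *: t + y s *: n) s 1.
  by apply/derivable_mxP => i j; rewrite ord1; have h := coord j; exact: ex_derive.
apply: DeriveDef => //; rewrite derive_mx//; apply/rowP => j; rewrite mxE.
by have h := coord j; rewrite derive_val.
Qed.

End Rows.

(** * Gradients of polynomials *)

Section Gradients.
Variable R : realType.
Implicit Types (F G : poly2 R) (p v : 'rV[R]_2).

Lemma gradM F G p : grad (F * G) p = evalp G p *: grad F p + evalp F p *: grad G p.
Proof.
apply/rowP => j.
by rewrite !mxE mpoly.mderivM /evalp mpoly.mevalD !mpoly.mevalM [X in X + _]mulrC.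
Qed.

Lemma gradD F G p : grad (F + G) p = grad F p + grad G p.
Proof. by apply/rowP => j; rewrite !mxE mpoly.mderivD /evalp mpoly.mevalD. Qed.

Lemma gradC (c : R) p : grad (mpoly.mpolyC 2 c) p = 0.
Proof. by apply/rowP => j; rewrite !mxE mpoly.mderivC /evalp mpoly.meval0. Qed.

Lemma gradX (i : 'I_2) p : grad (mpoly.mpolyX R (mpoly.mnm1 i)) p = \row_j (i == j)%:R.
Proof.
apply/rowP => j; rewrite !mxE mpoly.mderivX /evalp mpoly.mevalZ mpoly.mnm1E.
case: eqVneq => [->|]; last by rewrite mul0r.
by rewrite mpoly.mevalX big1 ?mulr1// => k _; rewrite mpoly.mnmBE subnn.
Qed.

Lemma affine_form p v : exists L : poly2 R, evalp L p = 0 /\ grad L p = v.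
Proof.
pose x i : poly2 R := mpoly.mpolyX R (mpoly.mnm1 i) + mpoly.mpolyC 2 (- p 0 i).
have x0 i : evalp (x i) p = 0.
  by rewrite /evalp mpoly.mevalD mpoly.mevalXU mpoly.mevalC subrr.
exists (mpoly.mpolyC 2 (v 0 0) * x 0 + mpoly.mpolyC 2 (v 0 1) * x 1); split.
  by rewrite /evalp mpoly.mevalD !mpoly.mevalM -!/(evalp _ _) !x0 !mulr0 addr0.
rewrite gradD !gradM !gradC !scaler0 !add0r /x !gradD !gradX !gradC !addr0.
by apply: rV2P; rewrite !mxE /evalp !mpoly.mevalC /= ?(mulr0, mulr1, addr0, add0r).
Qed.

(** Hadamard's form of differentiability: the increments of F are linear in q - p
    with coefficients depending continuously on both end points. *)
Definition is_slope F (H : 'rV[R]_2 -> 'rV[R]_2 -> 'rV[R]_2) : Prop :=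
  [/\ forall p q, evalp F q - evalp F p = dot (H p q) (q - p),
      forall p, H p p = grad F p &
      continuous (fun z : 'rV[R]_2 * 'rV[R]_2 => H z.1 z.2)].

Lemma slope_continuous F H : is_slope F H -> continuous (evalp F).
Proof.
move=> [FH _ Hc] /= p.
have FE q : evalp F q = evalp F p + dot (H p q) (q - p) by rewrite -FH addrC subrK.
have Hp : (fun q => H p q) @ p --> H p p.
  apply: (@continuous2_cvg _ _ _ _ (nbhs p) _ (fun=> p) id H p p).
  - exact: (Hc (p, p)).
  - exact: cvg_cst.
  - exact: cvg_id.
have qp : (fun q : 'rV[R]_2 => q - p) @ p --> p - p.
  by apply: (@cvgB _ _ _ (nbhs p)); [exact: cvg_id|exact: cvg_cst].
have lim : (fun q => evalp F p + dot (H p q) (q - p)) @ p --> evalp F p + dot (H p p) (p - p).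
  by apply: (@cvgD _ _ _ (nbhs p)); [exact: cvg_cst|exact: cvg_dot].
suff : (fun q => evalp F q) @ p --> evalp F p by [].
rewrite FE; under eq_fun do rewrite FE; exact: lim.
Qed.

Lemma slope_cst (c : R) : exists H, is_slope (mpoly.mpolyC 2 c) H.
Proof.
exists (fun _ _ => 0); split=> [p q|p|z].
- by rewrite /evalp !mpoly.mevalC subrr /dot !mxE !mul0r addr0.
- by rewrite gradC.
- exact: cvg_cst.
Qed.

Lemma slope_var (i : 'I_2) : exists H, is_slope (mpoly.mpolyX R (mpoly.mnm1 i)) H.
Proof.
exists (fun _ _ => \row_j (i == j)%:R); split=> [p q|p|z].
- rewrite /evalp !mpoly.mevalXU /dot !mxE.
  by case: i => -[|[|//]] ilt; rewrite !eqE/= ?(mul0r,mul1r,addr0,add0r);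
     congr (q 0 _ - p 0 _); exact: val_inj.
- by rewrite gradX.
- exact: cvg_cst.
Qed.

Lemma slope_add F G : (exists H, is_slope F H) -> (exists H, is_slope G H) ->
  exists H, is_slope (F + G) H.
Proof.
move=> [H [FH Hd Hc]] [K [GK Kd Kc]]; exists (fun p q => H p q + K p q); split=> [p q|p|z].
- rewrite /evalp !mpoly.mevalD -!/(evalp _ _) opprD addrACA FH GK /dot !mxE; ring.
- by rewrite Hd Kd gradD.
- by apply: cvgD; [exact: Hc|exact: Kc].
Qed.

Lemma slope_mul F G : (exists H, is_slope F H) -> (exists H, is_slope G H) ->
  exists H, is_slope (F * G) H.
Proof.
move=> [H sH] [K sK]; exists (fun p q => evalp G q *: H p q + evalp F p *: K p q).
have Fc := slope_continuous sH; have Gc := slope_continuous sK.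
case: sH sK => FH Hd Hc [GK Kd Kc]; split=> [p q|p|z].
- rewrite /evalp !mpoly.mevalM -!/(evalp _ _).
  have -> : evalp F q * evalp G q - evalp F p * evalp G p =
    (evalp F q - evalp F p) * evalp G q + evalp F p * (evalp G q - evalp G p) by ring.
  rewrite FH GK /dot !mxE; ring.
- by rewrite Hd Kd gradM.
- case: z => a b; apply: cvgD; apply: cvgZ; [|exact: Hc| |exact: Kc].
    by apply: (@cvg_comp _ _ _ snd (evalp G) _ (nbhs b)); [exact: cvg_snd|exact: Gc].
  by apply: (@cvg_comp _ _ _ fst (evalp F) _ (nbhs a)); [exact: cvg_fst|exact: Fc].
Qed.

(** Slopes exist for constants and variables, and the product rule
    F(q) G(q) - F(p) G(p) = (F(q) - F(p)) G(q) + F(p) (G(q) - G(p))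
    carries them over to products. *)
Lemma evalp_slope F : exists H, is_slope F H.
Proof.
have slopeX (m : mpoly.multinom 2) : exists H, is_slope (mpoly.mpolyX R m) H.
  rewrite mpoly.mpolyXE_id; apply: (big_ind (fun F => exists H, is_slope F H)) => [| |i _].
  - exact: (slope_cst 1).
  - exact: slope_mul.
  - set k := (X in _ ^+ X); elim: k => [|k IH]; first exact: (slope_cst 1).
    by rewrite exprS; apply: slope_mul => //; exact: slope_var.
elim/mpoly.mpolyind: F => [|c m F _ _ IH]; first exact: (slope_cst 0).
apply: slope_add => //; rewrite -mpoly.mul_mpolyC; apply: slope_mul => //.
exact: slope_cst.
Qed.

Lemma evalp_continuous F : continuous (evalp F).
Proof. by have [H] := evalp_slope F; exact: slope_continuous. Qed.

Lemma grad_continuous F : continuous (grad F).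
Proof.
move=> p; apply: (@cvg_row _ _ (nbhs p)) => j.
by under eq_fun do rewrite mxE; rewrite mxE; exact: evalp_continuous.
Qed.

Lemma evalv_continuous (X : vfield2 R) : continuous (evalv X).
Proof.
move=> p; apply: (@cvg_row _ _ (nbhs p)) => j.
by under eq_fun do rewrite mxE; rewrite mxE; exact: evalp_continuous.
Qed.

(** In the coordinates p + s t + u n, slopes of F paired with t and n are slopes in
    s and u, so that [implicit_function] applies. *)
Lemma local_curve F p t n : evalp F p = 0 -> dot (grad F p) n != 0 ->
  exists phi : R -> R, phi 0 = 0 /\
    \forall s \near (0 : R), let q := p + s *: t + phi s *: n in
      [/\ evalp F q = 0, dot (grad F q) n != 0 &
        is_derive (s : R) (1 : R) phi (- dot (grad F q) t / dot (grad F q) n)].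
Proof.
move=> F0 Dn; have [H [FH Hd Hc]] := evalp_slope F.
pose pt (z : R * R) := p + z.1 *: t + z.2 *: n.
have ptc : continuous pt.
  move=> z; apply: (@cvgD _ _ _ (nbhs z)).
    apply: (@cvgD _ _ _ (nbhs z)); first exact: cvg_cst.
    by apply: (@cvgZ _ _ _ (nbhs z)); [case: z => x y; exact: cvg_fst|exact: cvg_cst].
  by apply: (@cvgZ _ _ _ (nbhs z)); [case: z => x y; exact: cvg_snd|exact: cvg_cst].
have Hptc w : continuous (fun z : (R * R) * (R * R) => dot (H (pt z.1) (pt z.2)) w).
  case=> x y; apply: (@cvg_dot _ _ (nbhs (x, y))); last exact: cvg_cst.
  apply: (@continuous2_cvg _ _ _ _ (nbhs (x, y)) _ (pt \o fst) (pt \o snd) H (pt x) (pt y)).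
  - exact: (Hc (pt x, pt y)).
  - by apply: (@cvg_comp _ _ _ fst pt _ (nbhs x)); [exact: cvg_fst|exact: ptc].
  - by apply: (@cvg_comp _ _ _ snd pt _ (nbhs y)); [exact: cvg_snd|exact: ptc].
have [|||phi [phi0 phiP]] := @implicit_function R (fun s u => evalp F (pt (s, u)))
  (fun x y => dot (H (pt x) (pt y)) t) (fun x y => dot (H (pt x) (pt y)) n) _ (Hptc t) (Hptc n).
- by move=> s u s' u'; rewrite FH /dot /pt !mxE/=; ring.
- by rewrite /pt /= !scale0r !addr0.
- by rewrite Hd /pt /= !scale0r !addr0.
exists phi; split => //; apply: filterS phiP => s.
by rewrite !Hd.
Qed.

End Gradients.

(** * Intersection number one means transversality *)

(** Identities kept apart from the field of rational functions, in which they are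
    used, so that they are proved with opaque field operations. *)
Section FieldIdentities.
Variable K : fieldType.
Implicit Types (a b f g x y u w : K).

Lemma addf_lincomb a b f g f' g' : g != 0 -> g' != 0 ->
  a * (f / g) + b * (f' / g') = (a * f * g' + b * f' * g) / (g * g').
Proof. by move=> g0 g'0; field; rewrite g0 g'0. Qed.

Lemma lincomb_lincomb a b u w u' w' x y :
  a * (u * x + w * y) + b * (u' * x + w' * y) =
  (a * u + b * u') * x + (a * w + b * w') * y.
Proof. by ring. Qed.

Lemma clear_denominators f g f' g' x y : g != 0 -> g' != 0 ->
  (f / g * x + f' / g' * y) * (g * g') = f * g' * x + f' * g * y.
Proof. by move=> g0 g'0; field; rewrite g0 g'0. Qed.

Lemma lincomb_eliminate a b x y : a * (y - b * x) + (- b) * (1 - a * x) = a * y - b.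
Proof. by ring. Qed.

End FieldIdentities.

Section LocalRing.
Variable R : realType.
Implicit Types (F G h : poly2 R) (p v : 'rV[R]_2).
Local Notation frac := FracField.tofrac.

Lemma evalp_neq0 h p : evalp h p != 0 -> frac h != 0 :> {fraction (poly2 R)}.
Proof.
apply: contra_neq => /eqP; rewrite tofrac_eq0 => /eqP ->.
by rewrite /evalp mpoly.meval0.
Qed.

Lemma local_ringP h p : local_ring p (frac h).
Proof.
exists h, 1; split; first by rewrite /evalp mpoly.meval1 oner_eq0.
by rewrite tofrac1 divr1.
Qed.

Lemma local_ring_lincomb p (a b : R) x y : local_ring p x -> local_ring p y ->
  local_ring p (frac (mpoly.mpolyC 2 a) * x + frac (mpoly.mpolyC 2 b) * y).
Proof.
move=> [f [g [g0 ->]]] [f' [g' [g'0 ->]]].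
exists (mpoly.mpolyC 2 a * f * g' + mpoly.mpolyC 2 b * f' * g), (g * g'); split.
  by rewrite /evalp mpoly.mevalM mulf_neq0.
have gn := evalp_neq0 g0; have gn' := evalp_neq0 g'0.
rewrite tofracD !tofracM.
exact: addf_lincomb gn gn'.
Qed.

Lemma local_ideal_lincomb F G p (a b : R) x y :
  local_ideal F G p x -> local_ideal F G p y ->
  local_ideal F G p (frac (mpoly.mpolyC 2 a) * x + frac (mpoly.mpolyC 2 b) * y).
Proof.
move=> [u [w [uP wP ->]]] [u' [w' [uP' wP' ->]]].
exists (frac (mpoly.mpolyC 2 a) * u + frac (mpoly.mpolyC 2 b) * u'),
  (frac (mpoly.mpolyC 2 a) * w + frac (mpoly.mpolyC 2 b) * w').
split; [exact: local_ring_lincomb|exact: local_ring_lincomb|exact: lincomb_lincomb].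
Qed.

(** If v is tangent to both curves, the first-order jet along v, which is the
    morphism from O_p to the dual numbers sending x to x(p) + dx(v) epsilon,
    kills F and G and hence the ideal that they generate. *)
Lemma local_ideal_jet F G p v h : evalp F p = 0 -> evalp G p = 0 ->
  dot (grad F p) v = 0 -> dot (grad G p) v = 0 ->
  local_ideal F G p (frac h) -> evalp h p = 0 /\ dot (grad h p) v = 0.
Proof.
move=> F0 G0 dF dG [_ [_ [[f [g [g0 ->]]] [f' [g' [g'0 ->]]] hE]]].
have gn := evalp_neq0 g0; have gn' := evalp_neq0 g'0.
have {}hE : h * (g * g') = f * g' * F + f' * g * G.
  apply/eqP; rewrite -tofrac_eq tofracD !tofracM hE; apply/eqP.
  exact: clear_denominators gn gn'.
have evD A B : evalp (A + B) p = evalp A p + evalp B p by rewrite /evalp mpoly.mevalD.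
have evM A B : evalp (A * B) p = evalp A p * evalp B p by rewrite /evalp mpoly.mevalM.
have h0 : evalp h p = 0.
  have := congr1 (fun q => evalp q p) hE; rewrite /= evD !evM F0 G0 !mulr0 addr0 => /eqP.
  by rewrite !mulf_eq0 (negbTE g0) (negbTE g'0) !orbF => /eqP.
split=> //; have := congr1 (fun q => dot (grad q p) v) hE.
rewrite /= gradD (gradM h) (gradM _ F) (gradM _ G) !dotDl !dotZl F0 G0 dF dG h0 evM.
rewrite !mul0r !mulr0 !addr0 => /eqP.
by rewrite !mulf_eq0 (negbTE g0) (negbTE g'0) => /eqP.
Qed.

(** A common tangent vector v would give a map from O_p / (F, G) onto the
    two-dimensional algebra of first-order jets along v.  Concretely 1 and an
    affine form L with L(p) = 0 and dL = v would be proportional modulo the ideal,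
    but their jets (1, 0) and (0, |v|^2) are independent. *)
Lemma intersection_number1_transverse F G p :
  evalp F p = 0 -> evalp G p = 0 -> intersection_number F G p 1 ->
  wedge (grad F p) (grad G p) != 0.
Proof.
move=> F0 G0 [e [_ eP]]; apply/eqP => /dependent_kernel[v vn0 [dF dG]].
have [L [L0 LE]] := affine_form p v.
have jet := local_ideal_jet F0 G0 dF dG.
have [c1 [+ _]] := eP _ (local_ringP 1 p); rewrite big_ord1 => I1.
have [c2 [+ _]] := eP _ (local_ringP L p); rewrite big_ord1 => I2.
set a := c1 0 0 in I1; set b := c2 0 0 in I2.
have : local_ideal F G p (frac (mpoly.mpolyC 2 a * L - mpoly.mpolyC 2 b)).
  have := local_ideal_lincomb a (- b) I2 I1.
  by rewrite mpoly.mpolyCN tofracN tofrac1 lincomb_eliminate -tofracM -tofracB.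
move=> /jet [ev dv].
have a0 : a = 0.
  move: dv; rewrite gradD -mpoly.mpolyCN gradM !gradC L0 LE /evalp mpoly.mevalC.
  rewrite scaler0 add0r addr0 /dot !mxE => /eqP.
  rewrite -!mulrA -mulrDr mulf_eq0 => /orP[/eqP//|].
  rewrite paddr_eq0 ?sqr_ge0 -?expr2 ?sqr_ge0// !sqrf_eq0 => /andP[/eqP v0 /eqP v1].
  by case/eqP: vn0; apply: rV2P; rewrite mxE.
move: I1; rewrite a0 mpoly.mpolyC0 tofrac0 mul0r subr0 => /jet[/eqP + _].
by rewrite /evalp mpoly.meval1 oner_eq0.
Qed.
End LocalRing.

(** * The reduced flow *)

Section ReducedFlow.
Variable R : realType.
Implicit Types (F G : poly2 R) (N X : vfield2 R) (p v w : 'rV[R]_2).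

Lemma sub_tangent F p v : (v <= tangent F p)%MS = (dot (grad F p) v == 0).
Proof.
have -> : dot (grad F p) v = (v *m (grad F p)^T) 0 0.
  rewrite mxE !big_ord_recl big_ord0 addr0 !mxE (_ : lift ord0 ord0 = 1); last exact: val_inj.
  by rewrite /dot !mxE mulrC [X in _ + X]mulrC.
rewrite /tangent sub_kermx; apply/eqP/eqP => [->|d0]; first by rewrite mxE.
by apply/matrixP => i j; rewrite !ord1 d0 mxE.
Qed.

Lemma tangency_dot F p v :
  (forall w : 'rV[R]_2, (w <= tangent F p)%MS -> wedge v w = 0) ->
  dot (grad F p) v = 0.
Proof.
move=> tang; rewrite dotC -wedge_rot; apply: tang.
by rewrite sub_tangent dot_rot wedge_self.
Qed.

(** The projection of X onto the kernel of dF along N.  Unlike [reduced], it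
    involves only one of the two components, and is continuous also at the
    singular point when N is transverse to V(F) there. *)
Definition slide F N X p : 'rV[R]_2 :=
  evalv X p - (dot (grad F p) (evalv X p) / dot (grad F p) (evalv N p)) *: evalv N p.

Lemma slide_tangent F N X p : dot (grad F p) (evalv N p) != 0 ->
  dot (grad F p) (slide F N X p) = 0.
Proof. by move=> D0; rewrite /slide dotBr dotZr divfK// subrr. Qed.

Lemma slide_continuous F N X p : dot (grad F p) (evalv N p) != 0 ->
  {for p, continuous (slide F N X)}.
Proof.
move=> D0; have Xc := @evalv_continuous _ X p; have Nc := @evalv_continuous _ N p.
have gc := @grad_continuous _ F p.
apply: (@cvgB _ _ _ (nbhs p)); first exact: Xc.
apply: (@cvgZ _ _ _ (nbhs p)); last exact: Nc.
apply: (@cvgM _ _ (nbhs p)); first exact: cvg_dot.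
by apply: (@cvgV _ _ (nbhs p)) => //; exact: cvg_dot.
Qed.

Lemma transverse_near F N p : dot (grad F p) (evalv N p) != 0 ->
  \forall q \near p, dot (grad F q) (evalv N q) != 0.
Proof.
have gN : (fun q => dot (grad F q) (evalv N q)) @ p --> dot (grad F p) (evalv N p).
  by apply: (@cvg_dot _ _ (nbhs p)); [exact: grad_continuous|exact: evalv_continuous].
exact: (cvgr_neq0 _ gN).
Qed.

Section AtSlowPoint.
Variables (F G : poly2 R) (N X : vfield2 R) (p : 'rV[R]_2).
Hypotheses (F0 : evalp F p = 0) (G0 : evalp G p != 0).
Hypothesis D0 : dot (grad F p) (evalv N p) != 0.

Let sub_tangentM v : (v <= tangent (F * G)%R p)%MS = (dot (grad F p) v == 0).
Proof.
rewrite sub_tangent gradM F0 scale0r addr0.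
by rewrite dotZl mulf_eq0 (negbTE G0).
Qed.

Lemma fast_transverseM : fast_transverse (F * G) N p.
Proof.
rewrite /fast_transverse -sub1mx; apply/row_subP => i; set w := row i _.
rewrite -[w](subrK (dot (grad F p) w / dot (grad F p) (evalv N p) *: evalv N p)).
apply: addmx_sub_adds; last exact: scalemx_sub.
by rewrite sub_tangentM; rewrite dotBr dotZr divfK// subrr.
Qed.

Lemma reducedM : reduced (F * G) N X p = slide F N X p.
Proof.
have cap0 : (tangent (F * G)%R p :&: <<evalv N p>>)%MS = 0.
  apply/eqP; rewrite -submx0; apply/rV_subP => w.
  rewrite sub_capmx sub_tangentM genmxE => /andP[/[swap] /sub_rVP[k ->]].
  by rewrite dotZr mulf_eq0 (negbTE D0) orbF => /eqP ->; rewrite scale0r sub0mx.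
rewrite /reduced -{1}[evalv X p](subrK (dot (grad F p) (evalv X p) /
  dot (grad F p) (evalv N p) *: evalv N p)) mulmxDl.
rewrite [X in _ + X]proj_mx_0// ?addr0; last by rewrite genmxE scalemx_sub.
by rewrite proj_mx_id// sub_tangentM; apply/eqP; exact: slide_tangent.
Qed.

End AtSlowPoint.
End ReducedFlow.

(** * The canard along one branch *)

Section Canard.
Variable R : realType.
Variables (X0 N X1 : vfield2 R) (F G : poly2 R) (ps : 'rV[R]_2) (U : set 'rV[R]_2).
Hypotheses (U_open : open U) (U_ps : U ps).
Hypothesis crit : forall p, U p -> V F p -> critical_variety X0 p.
Hypothesis crossing : V F `&` V G `&` U = [set ps].
Hypothesis transverse : wedge (grad F ps) (grad G ps) != 0.
Hypothesis N_ps : evalv N ps != 0.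
Hypothesis X1_ps : evalv X1 ps != 0.
Hypothesis no_eq : ~ equilibrium_at_ps (F * G) N X1 ps U G.
Hypothesis tangency : dot (grad F ps) (evalv X1 ps) = 0.

Let F_ps : evalp F ps = 0.
Proof. by have : [set ps] ps by []; rewrite -crossing => -[[]]. Qed.

Let off_ps p : U p -> p <> ps -> evalp F p = 0 -> evalp G p != 0.
Proof.
move=> Up pps F0; apply/eqP => G0; apply: pps.
by have : (V F `&` V G `&` U) p by []; rewrite crossing.
Qed.

(** Otherwise N(ps) and X1(ps) would both span the tangent of V(F), so that the
    slide of X1 along V(G), continuous at [ps], would vanish there. *)
Lemma fast_direction_transverse : dot (grad F ps) (evalv N ps) != 0.
Proof.
apply/eqP => FN; apply: no_eq.
have GN : dot (grad G ps) (evalv N ps) != 0.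
  by apply: contraNneq N_ps => GN; apply/eqP; exact: wedge_dot_eq0 transverse FN GN.
have slide0 : slide G N X1 ps = 0.
  have := slide_tangent X1 GN; apply: wedge_dot_eq0 transverse _.
  by rewrite /slide dotBr dotZr tangency FN mulr0 subrr.
rewrite /equilibrium_at_ps -slide0.
have lim := @slide_continuous _ _ _ X1 _ GN.
apply: cvg_trans (cvg_within_filter _ lim).
apply: near_eq_cvg; rewrite /prop_near1 /within /=.
apply: filterS (transverse_near GN) => p D0 [Gp [Up _ pps _]]; rewrite mulrC reducedM//.
apply/eqP => F0; apply: pps.
by have : (V F `&` V G `&` U) p by []; rewrite crossing.
Qed.

(** The trajectory of the slide E of X1 through [ps], which the scalar equation
    S' = lam(S) turns from the graph c into a solution: gamma' = S' c'(S) =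
    lam(S) c'(S) = E(gamma). *)
Lemma canard_along : exists gamma delta,
  singular_canard (F * G) N X1 ps U X0 gamma delta /\
  forall t, `|t| < delta -> V F (gamma t).
Proof.
have D0 := fast_direction_transverse.
pose t := evalv X1 ps; pose n := evalv N ps; pose E := slide F N X1.
have Eps : E ps = t by rewrite /E /slide tangency mul0r scale0r subr0.
have tn : wedge t n != 0.
  apply: contraNneq X1_ps => tn0; apply/eqP.
  have := colinear_dot (grad F ps) tn0.
  rewrite tangency scale0r => /eqP.
  by rewrite scaler_eq0 (negbTE D0) => /eqP.
have [phi [phi0 phiP]] := local_curve t F_ps D0.
pose c s := ps + s *: t + phi s *: n.
have c0 : c 0 = ps by rewrite /c phi0 !scale0r !addr0.
(* the factor in E (c s) = lam s *: c' s, by [tangent_graph_velocity] *)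
pose lam s := wedge (E (c s)) n / wedge t n.
have dc : \forall s \near (0 : R), is_derive (s : R) (1 : R) c
    (t + (- dot (grad F (c s)) t / dot (grad F (c s)) n) *: n).
  apply: filterS phiP => s [_ _ dphi]; rewrite -[X in X + _]scale1r.
  exact: is_derive_curve.
have cc : \forall s \near (0 : R), {for s, continuous c}.
  apply: filterS dc => s h; apply: differentiable_continuous; apply/derivable1_diffP.
  exact: ex_derive.
have c_ps : c @ (0 : R) --> ps by have := nbhs_singleton cc; rewrite /prop_for /continuous_at c0.
have DN : \forall s \near (0 : R), dot (grad F (c s)) (evalv N (c s)) != 0.
  exact: (c_ps _ (transverse_near D0)).
have Ec s : dot (grad F (c s)) (evalv N (c s)) != 0 -> {for s, continuous c} ->
    (fun s => E (c s)) @ s --> E (c s).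
  move=> Ds cs; apply: (@cvg_comp _ _ _ c E _ (nbhs (c s))); first exact: cs.
  exact: slide_continuous.
have lamc : \forall s \near (0 : R), {for s, continuous lam}.
  near=> s; apply: (@cvgM _ _ (nbhs s)); last exact: cvg_cst.
  apply: (@cvg_wedge _ _ (nbhs s)); last exact: cvg_cst.
  by apply: Ec; near: s.
have lam0 : 0 < lam 0 by rewrite /lam c0 Eps divff.
have [S [S0 dS]] := scalar_flow lamc lam0.
have Sc : \forall r \near (0 : R), {for r, continuous S}.
  apply: filterS dS => r h; apply: differentiable_continuous; apply/derivable1_diffP.
  exact: ex_derive.
have S_0 : S @ (0 : R) --> (0 : R).
  by have := nbhs_singleton Sc; rewrite /prop_for /continuous_at S0.
pose gamma r := c (S r).
have good : \forall r \near (0 : R), [/\ U (gamma r), evalp F (gamma r) = 0,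
    dot (grad F (gamma r)) (evalv N (gamma r)) != 0,
    is_derive (r : R) (1 : R) gamma (E (gamma r)) &
    (fun r => E (gamma r)) @ r --> E (gamma r)].
  have onS (A : set R) : nbhs (0 : R) A -> \forall r \near (0 : R), A (S r) by exact: S_0.
  have US : \forall r \near (0 : R), U (c (S r)).
    exact: (onS (fun s => U (c s)) (c_ps U (open_nbhs_nbhs (conj U_open U_ps)))).
  have phiS := onS _ phiP; have DS := onS _ DN; have cS := onS _ cc.
  near=> r.
  have [FS nS dphi] : let q := c (S r) in [/\ evalp F q = 0, dot (grad F q) n != 0 &
    is_derive (S r : R) (1 : R) phi (- dot (grad F q) t / dot (grad F q) n)] by near: r.
  have Dr : dot (grad F (c (S r))) (evalv N (c (S r))) != 0 by near: r.
  have dSr : is_derive (r : R) (1 : R) S (lam (S r)) by near: r.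
  split => //; first by near: r.
  - have eE := @tangent_graph_velocity _ (grad F (c (S r))) t n (E (c (S r))).
    rewrite /gamma {1}eE//; last exact: slide_tangent.
    rewrite -/(lam _) scalerDr scalerA mulrC; exact: is_derive_curve.
  - have Scr : {for r, continuous S} by near: r.
    have ccr : {for S r, continuous c} by near: r.
    apply: (@cvg_comp _ _ _ S (fun s => E (c s)) _ (nbhs (S r))); first exact: Scr.
    exact: Ec.
have [d /= d0 goodd] := (nbhs_ballP _ _).1 good.
have in_ball (r : R) : `|r| < d -> ball (0 : R) d r by rewrite -ball_normE/= sub0r normrN.
have velocity r : `|r| < d -> derive1 gamma r = E (gamma r).
  move=> /in_ball/goodd[_ _ _ h _]; rewrite derive1E; exact: derive_val.
have gamma0 : gamma 0 = ps by rewrite /gamma S0.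
exists gamma, d; split; last by move=> r /in_ball/goodd[].
split => //.
- move=> r rd; have [_ _ _ dr Er] := goodd _ (in_ball _ rd); split; first exact: ex_derive.
  rewrite /prop_for /continuous_at velocity//.
  apply: cvg_trans Er; apply: near_eq_cvg.
  have : \forall z \near r, `|z| < d.
    by apply: (@cvgr_norm_lt _ _ _ (nbhs r) _ id r) => //; exact: cvg_id.
  by apply: filterS => z zd; rewrite velocity.
- by move=> r /in_ball/goodd[Ur Fr _ _ _]; split => //; exact: crit.
- by split => //; rewrite velocity ?normr0// gamma0 Eps.
move=> r rd rps; have [Ur Fr Dr _ _] := goodd _ (in_ball _ rd).
have Gr := off_ps Ur rps Fr; split; last by rewrite velocity// reducedM.
split => //; last exact: fast_transverseM.
by rewrite /V /= /evalp mpoly.mevalM -!/(evalp _ _) Fr mul0r.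
Unshelve. all: by end_near. Qed.
End Canard.

Theorem lemma2p11 (R : realType) (X0 X1 : vfield2 R) (F1 F2 : poly2 R)
    (N : vfield2 R) (ps : 'rV[R]_2) (U : set 'rV[R]_2)
    (U_open : open U) (U_ps : U ps)
    (irr1 : irreducible F1) (irr2 : irreducible F2)
    (X0E : X0 = (F1 * F2) *: N)
    (critE : critical_variety X0 `&` U = (V F1 `|` V F2) `&` U)
    (crossing : V F1 `&` V F2 `&` U = [set ps])
    (inter1 : intersection_number F1 F2 ps 1)
    (rank_max : forall p, U p -> critical_variety X0 p -> p <> ps ->
       \rank (jac X0 p) = 1%N)
    (foliation : forall p, U p -> evalv N p != 0)
    (transv1 : generically_transverse (F1 * F2) N ps U F1)
    (transv2 : generically_transverse (F1 * F2) N ps U F2)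
    (X1_ps : evalv X1 ps != 0)
    (no_eq : forall p, slow_points (F1 * F2) N ps U p ->
       reduced (F1 * F2) N X1 p != 0)
    (no_eq_ps1 : ~ equilibrium_at_ps (F1 * F2) N X1 ps U F1)
    (no_eq_ps2 : ~ equilibrium_at_ps (F1 * F2) N X1 ps U F2) :
  ((forall v : 'rV[R]_2, (v <= tangent F1 ps)%MS -> wedge (evalv X1 ps) v = 0) ->
     exists gamma delta,
       singular_canard (F1 * F2) N X1 ps U X0 gamma delta /\
       forall t, `|t| < delta -> V F1 (gamma t)) /\
  ((forall v : 'rV[R]_2, (v <= tangent F2 ps)%MS -> wedge (evalv X1 ps) v = 0) ->
     exists gamma delta,
       singular_canard (F1 * F2) N X1 ps U X0 gamma delta /\
       forall t, `|t| < delta -> V F2 (gamma t)).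
Proof.
have F_ps : evalp F1 ps = 0 /\ evalp F2 ps = 0.
  by have : [set ps] ps by []; rewrite -crossing => -[[]].
have transverse := intersection_number1_transverse F_ps.1 F_ps.2 inter1.
have crit p : U p -> (V F1 `|` V F2) p -> critical_variety X0 p.
  move=> Up Fp; have : ((V F1 `|` V F2) `&` U) p by [].
  by rewrite -critE => -[].
have N_ps := foliation ps U_ps.
split=> /tangency_dot tangency.
  by apply: canard_along => // p Up Fp; apply: crit => //; left.
rewrite mulrC; apply: canard_along => //.
- by move=> p Up Fp; apply: crit => //; right.
- by rewrite [V F2 `&` _]setIC.
- by rewrite wedge_antisym oppr_eq0.
- by rewrite mulrC.
Qed.
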